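(* Let $K$ be a division ring and $\Gamma$ a group. If the group ring $K[\Gamma\times H]$ is directly finite for every finite group $H$, then $K[\Gamma]$ is stably finite.
   Context: For a division ring $K$ and a group $G$, $K[G]$ denotes the group ring (the $K$-algebra with basis $G$, coefficients from $K$ commuting with the elements of $G$). A unital ring $A$ is directly finite if $ab=1$ implies $ba=1$ for all $a,b\in A$; it is stably finite if the matrix ring $M_n(A)$ is directly finite for every positive integer $n$. *)

(* Defs.v *)
From HB Require Import structures.
From mathcomp Require Import all_boot all_algebra fingroup.
From mathcomp Require Import finmap.
From mathcomp.multinomials Require Import monalg.

Set Implicit Arguments.
Unset Strict Implicit.
Unset Printing Implicit Defensive.

Import GRing.Theory.
Local Open Scope ring_scope.
Local Open Scope fset_scope.

Definition is_division_ring (K : nzRingType) : Prop :=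
  forall x : K, x != 0 -> exists y : K, x * y = 1 /\ y * x = 1.

Definition directly_finite (A : nzRingType) : Prop :=
  forall a b : A, a * b = 1 -> b * a = 1.

Definition stably_finite (A : nzRingType) : Prop :=
  forall m : nat, directly_finite 'M[A]_m.+1.

Section ProdGroup.
Variables (G H : groupType).
Local Open Scope group_scope.

Definition prod_group : Type := (G * H)%type.
HB.instance Definition _ := Choice.on prod_group.

Definition pg_one : prod_group := (1, 1).
Definition pg_mul (x y : prod_group) : prod_group := (x.1 * y.1, x.2 * y.2).
Definition pg_inv (x : prod_group) : prod_group := (x.1^-1, x.2^-1).

Fact pg_mulA : associative pg_mul.
Proof. by move=> [a b] [c d] [e f]; rewrite /pg_mul /= !mulgA. Qed.
Fact pg_mul1 : left_id pg_one pg_mul.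
Proof. by move=> [a b]; rewrite /pg_mul /= !mul1g. Qed.
Fact pg_mulr1 : right_id pg_one pg_mul.
Proof. by move=> [a b]; rewrite /pg_mul /= !mulg1. Qed.
Fact pg_mulV : left_inverse pg_one pg_inv pg_mul.
Proof. by move=> [a b]; rewrite /pg_mul /= !mulVg. Qed.
Fact pg_mulrV : right_inverse pg_one pg_inv pg_mul.
Proof. by move=> [a b]; rewrite /pg_mul /= !mulgV. Qed.

HB.instance Definition _ := isGroup.Build prod_group
  pg_mulA pg_mul1 pg_mulr1 pg_mulV pg_mulrV.
End ProdGroup.

(* Built on monalg's {malg K[G]} (finitely supported maps), with the   *)
(* multiplication copied from monalg's monoid-algebra construction     *)
(* (which there requires a monomial monoid; here G is a group).        *)

Definition group_ring (R : nzRingType) (G : groupType) : predArgType :=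
  {malg R[G]}.

HB.instance Definition _ R G := GRing.Zmodule.on (group_ring R G).

Section GroupRing.
Context (R : nzRingType) (G : groupType).

Implicit Types (g : group_ring R G) (k l : G).

Definition grone : group_ring R G := << 1%g >>.

Definition grmul g1 g2 : group_ring R G :=
  \sum_(k1 <- msupp g1) \sum_(k2 <- msupp g2)
     << g1@_k1 * g2@_k2 *g (k1 * k2)%g >>.

Lemma grmull g1 g2 : grmul g1 g2 = \sum_(k1 <- msupp g1) \sum_(k2 <- msupp g2)
     << g1@_k1 * g2@_k2 *g (k1 * k2)%g >>.
Proof. by []. Qed.

Lemma grmulr g1 g2 : grmul g1 g2 = \sum_(k2 <- msupp g2) \sum_(k1 <- msupp g1)
     << g1@_k1 * g2@_k2 *g (k1 * k2)%g >>.
Proof. by rewrite grmull exchange_big. Qed.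

Lemma grmullw (d1 d2 : {fset G}) g1 g2 :
  msupp g1 `<=` d1 -> msupp g2 `<=` d2 ->
  grmul g1 g2 = \sum_(k1 <- d1) \sum_(k2 <- d2)
     << g1@_k1 * g2@_k2 *g (k1 * k2)%g >>.
Proof.
move=> le_d1 le_d2; rewrite grmull (big_fset_incl _ le_d1) /=.
  apply/eq_bigr=> k1 _; apply/big_fset_incl => // k _ /mcoeff_outdom ->.
  by rewrite mulr0 monalgU0.
move=> k _ /mcoeff_outdom g1k.
by rewrite big1 => // k' _; rewrite g1k mul0r monalgU0.
Qed.

Lemma grmulrw (d1 d2 : {fset G}) g1 g2 : msupp g1 `<=` d1 -> msupp g2 `<=` d2
  -> grmul g1 g2 = \sum_(k2 <- d2) \sum_(k1 <- d1)
     << g1@_k1 * g2@_k2 *g (k1 * k2)%g >>.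
Proof. by move=> le_d1 le_d2; rewrite (grmullw le_d1 le_d2) exchange_big. Qed.

Lemma grmul0g : left_zero 0 grmul.
Proof. by move=> g; rewrite grmull msupp0 big_seq_fset0. Qed.

Lemma grmulg0 : right_zero 0 grmul.
Proof. by move=> g; rewrite grmulr msupp0 big_seq_fset0. Qed.

Lemma grmulUg c k g :
  grmul << c *g k >> g = \sum_(k' <- msupp g) << c * g@_k' *g (k * k')%g >>.
Proof.
rewrite (grmullw msuppU_le (fsubset_refl _)) big_seq_fset1.
by apply/eq_bigr => k' _; rewrite mcoeffUU.
Qed.

Lemma grmulgU c k g :
  grmul g << c *g k >> = \sum_(k' <- msupp g) << g@_k' * c *g (k' * k)%g >>.
Proof.
rewrite (grmulrw (fsubset_refl _) msuppU_le) big_seq_fset1.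
by apply/eq_bigr=> k' _; rewrite mcoeffUU.
Qed.

Lemma grmulUU c1 c2 k1 k2 :
  grmul << c1 *g k1 >> << c2 *g k2 >> = << c1 * c2 *g (k1 * k2)%g >>.
Proof. by rewrite (grmulrw msuppU_le msuppU_le) !big_seq_fset1 !mcoeffUU. Qed.

Lemma grmulEl1 g1 g2 :
  grmul g1 g2 = \sum_(k1 <- msupp g1) grmul << g1@_k1 *g k1 >> g2.
Proof. by apply/eq_bigr=> k _; rewrite grmulUg. Qed.

Lemma grmulEr1 g1 g2 :
  grmul g1 g2 = \sum_(k2 <- msupp g2) grmul g1 << g2@_k2 *g k2 >>.
Proof. by rewrite grmulr; apply/eq_bigr=> k _; rewrite grmulgU. Qed.

Lemma grmul1g : left_id grone grmul.
Proof.
move=> g; rewrite grmulUg [RHS]monalgE.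
by apply/eq_bigr=> kg _; rewrite mul1r mul1g.
Qed.

Lemma grmulg1 : right_id grone grmul.
Proof.
move=> g; rewrite grmulgU [RHS]monalgE.
by apply/eq_bigr=> k _; rewrite mulr1 mulg1.
Qed.

Lemma grmulgDl : left_distributive grmul +%R.
Proof.
move=> g1 g2 g.
rewrite [in RHS](@grmullw _ (msupp g) g1 g (fsubsetUl _ (msupp g2)) (fsubset_refl _)).
rewrite [in RHS](@grmullw _ (msupp g) g2 g (fsubsetUr (msupp g1) _) (fsubset_refl _)).
rewrite (@grmullw _ (msupp g) _ g (msuppD_le _ _) (fsubset_refl _)).
rewrite -big_split /=; apply/eq_bigr=> k1 _.
rewrite -big_split /=; apply/eq_bigr=> k2 _.
by rewrite mcoeffD mulrDl monalgUD.
Qed.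

Lemma grmulgDr : right_distributive grmul +%R.
Proof.
move=> g g1 g2.
rewrite [in RHS](@grmulrw (msupp g) _ g g1 (fsubset_refl _) (fsubsetUl _ (msupp g2))).
rewrite [in RHS](@grmulrw (msupp g) _ g g2 (fsubset_refl _) (fsubsetUr (msupp g1) _)).
rewrite (@grmulrw (msupp g) _ g _ (fsubset_refl _) (msuppD_le _ _)).
rewrite -big_split /=; apply/eq_bigr => k1 _.
rewrite -big_split /=; apply/eq_bigr => k2 _.
by rewrite mcoeffD mulrDr monalgUD.
Qed.

Lemma grmulA : associative grmul.
Proof.
move=> g1 g2 g3.
rewrite [RHS](big_morph (grmul^~ _) (fun _ _ => grmulgDl _ _ _) (grmul0g _)).
rewrite grmulEl1; apply/eq_bigr=> k1 _.
rewrite [LHS](big_morph (grmul _) (fun _ _ => grmulgDr _ _ _) (grmulg0 _)).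
rewrite [RHS](big_morph (grmul^~ _) (fun _ _ => grmulgDl _ _ _) (grmul0g _)).
apply/eq_bigr=> k2 _.
rewrite [LHS](big_morph (grmul _) (fun _ _ => grmulgDr _ _ _) (grmulg0 _)).
by rewrite grmulEr1; apply/eq_bigr=> k3 _; rewrite !grmulUU mulrA mulgA.
Qed.

Lemma groner_eq0 : grone != 0.
Proof. by apply/eqP/malgP=> /(_ 1%g) /eqP; rewrite mcoeffU eqxx mcoeff0 oner_eq0. Qed.

HB.instance Definition _ := GRing.Zmodule_isNzRing.Build (group_ring R G)
  grmulA grmul1g grmulg1 grmulgDl grmulgDr groner_eq0.

End GroupRing.

Lemma group_ring_mulE (R : nzRingType) (G : groupType) (a b : group_ring R G) :
  a * b = grmul a b.
Proof. by []. Qed.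

(* Main.v *)
(* Let C be a cyclic group of order 2 or 3, whichever is invertible in K, and H
   the wreath product of C by Z/n.  For each coordinate i, averaging over the
   elements of C^n that are trivial at i, minus averaging over all of C^n, gives
   an idempotent f_i in K[H].  The f_i are orthogonal and nonzero, and they are
   permuted cyclically by the shift t, so the f_i t^(j - i) are n x n matrix
   units commuting with K.  They embed M_n(K[Gamma]), not unitally, into
   K[Gamma x H], and direct finiteness passes to corners. *)
Require Import Defs.
From HB Require Import structures.
From mathcomp Require Import all_boot all_algebra fingroup.
From mathcomp Require Import finmap.
From mathcomp.multinomials Require Import monalg.

Set Implicit Arguments.
Unset Strict Implicit.
Unset Printing Implicit Defensive.

Import GRing.Theory.
Local Open Scope ring_scope.

(** * Matrix rings inside a ring with matrix units *)

Section MatrixUnits.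
Variables (R S : nzRingType) (n : nat) (phi : {additive R -> S}).
Variable E : 'I_n.+1 -> 'I_n.+1 -> S.
Hypothesis phiM : {morph phi : x y / x * y}.
Hypothesis phiE : forall a i j, phi a * E i j = E i j * phi a.
Hypothesis EM : forall i j k l, E i j * E k l = E i l *+ (j == k).
Hypothesis phiE_inj : forall a, phi a * E 0 0 = 0 -> a = 0.

Definition matrix_embedding (M : 'M[R]_n.+1) : S :=
  \sum_i \sum_j phi (M i j) * E i j.

Lemma matrix_embeddingM : {morph matrix_embedding : M N / M * N}.
Proof.
move=> M N; rewrite /matrix_embedding mulr_suml /=; apply: eq_bigr => i _.
rewrite mulr_suml /=.
transitivity (\sum_j \sum_l phi (M i j * N j l) * E i l).
  rewrite exchange_big /=; apply: eq_bigr => l _.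
  by rewrite mxE raddf_sum mulr_suml.
apply: eq_bigr => j _; rewrite mulr_sumr [RHS](bigD1 j) //= [X in _ + X]big1 ?addr0.
  rewrite mulr_sumr /=; apply: eq_bigr => l _.
  by rewrite -mulrA [E i j * _]mulrA -phiE -mulrA EM eqxx mulr1n phiM !mulrA.
move=> k nkj; rewrite mulr_sumr big1 //= => l _.
by rewrite -mulrA [E i j * _]mulrA -phiE -mulrA EM eq_sym (negbTE nkj) !mulr0.
Qed.

Lemma matrix_embeddingB M N :
  matrix_embedding (M - N) = matrix_embedding M - matrix_embedding N.
Proof.
rewrite /matrix_embedding -sumrB; apply: eq_bigr => i _; rewrite -sumrB.
by apply: eq_bigr => j _; rewrite !mxE raddfB mulrBl.
Qed.

(** Multiplying the image by [E 0 i] on the left and [E j 0] on the right isolates the entry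
    [M i j], carried by the single unit [E 0 0]; this is why [phiE_inj] speaks of that unit only. *)
Lemma matrix_embedding_eq0 M : matrix_embedding M = 0 -> M = 0.
Proof.
move=> M0; apply/matrixP => i j; rewrite mxE; apply: phiE_inj.
have <- : E 0 i * matrix_embedding M * E j 0 = phi (M i j) * E 0 0.
  rewrite mulr_sumr mulr_suml (bigD1 i) //= [X in _ + X]big1 ?addr0.
    rewrite mulr_sumr mulr_suml (bigD1 j) //= [X in _ + X]big1 ?addr0.
      by rewrite mulrA -phiE -mulrA -mulrA EM eqxx mulr1n EM eqxx mulr1n.
    move=> k nkj; rewrite mulrA -phiE -2!mulrA [E i k * _]EM (negbTE nkj).
    by rewrite mulr0n !mulr0.
  move=> k nki; rewrite mulr_sumr mulr_suml big1 //= => l _.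
  by rewrite mulrA -phiE -[phi _ * _ * _]mulrA EM eq_sym (negbTE nki) mulr0 mul0r.
by rewrite M0 mulr0 mul0r.
Qed.

(* The embedding is not unital: its image has unit [e], and elements of the
   corner [e S e] are completed by [1 - e] to apply direct finiteness in [S]. *)
Lemma directly_finite_matrix : directly_finite S -> directly_finite 'M[R]_n.+1.
Proof.
move=> dfS M N MN1; pose e := matrix_embedding 1.
have eP P : e * matrix_embedding P = matrix_embedding P.
  by rewrite -matrix_embeddingM mul1r.
have Pe P : matrix_embedding P * e = matrix_embedding P.
  by rewrite -matrix_embeddingM mulr1.
pose f := 1 - e.
have Pf P : matrix_embedding P * f = 0 by rewrite mulrBr mulr1 Pe subrr.
have fP P : f * matrix_embedding P = 0 by rewrite mulrBl mul1r eP subrr.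
have ff : f * f = f by rewrite {2}/f mulrBr mulr1 fP subr0.
have corner P Q : (matrix_embedding P + f) * (matrix_embedding Q + f)
    = matrix_embedding (P * Q) + f.
  by rewrite mulrDl mulrDr Pf mulrDr fP ff addr0 add0r matrix_embeddingM.
have /dfS : (matrix_embedding M + f) * (matrix_embedding N + f) = 1.
  by rewrite corner MN1 -/e addrC subrK.
rewrite corner => /(canRL (addrK _)) NM1; apply/eqP; rewrite -subr_eq0; apply/eqP.
apply: matrix_embedding_eq0; rewrite matrix_embeddingB -/e NM1 /f.
by rewrite opprB addrCA subrr addr0 subrr.
Qed.

End MatrixUnits.

(** * Averages over subsets of H in the group ring of the product *)

Section Lift.
Variables (K : nzRingType) (G : groupType) (H : finGroupType).
Notation R := (group_ring K G).
Notation S := (group_ring K (prod_group G H)).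
Implicit Types (a b : R) (g h : H) (X : {set H}).

(* [grlift h a] is the element of [K[G x H]] corresponding to [a ⊗ h]. *)
Definition grlift h a : S :=
  \sum_(k <- msupp a) << a@_k *g ((k, h) : prod_group G H) >>.

Lemma mcoeff_grlift h a k g : (grlift h a)@_(k, g) = a@_k *+ (h == g).
Proof.
rewrite /grlift raddf_sum /=.
case: (boolP (k \in msupp a)) => [ka|ka].
  rewrite (big_fsetD1 k) //= mcoeffU xpair_eqE eqxx big_seq big1 ?addr0 //.
  move=> l; rewrite !inE => /andP[/negbTE nlk _].
  by rewrite mcoeffU xpair_eqE nlk.
rewrite mcoeff_outdom // mul0rn big_seq big1 // => l la.
rewrite mcoeffU xpair_eqE; case: eqP => //= lk.
by rewrite -lk la in ka.
Qed.

Lemma grlift_is_additive h : additive (grlift h).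
Proof.
move=> a b; apply/malgP => -[k g].
by rewrite mcoeffB !mcoeff_grlift mcoeffB mulrnBl.
Qed.
HB.instance Definition _ h :=
  GRing.isZmodMorphism.Build R S (grlift h) (grlift_is_additive h).

Lemma grliftU h c k : grlift h << c *g k >> = << c *g ((k, h) : prod_group G H) >>.
Proof.
apply/malgP => -[l g]; rewrite mcoeff_grlift !mcoeffU xpair_eqE -mulrnA.
by rewrite mulnb.
Qed.

Lemma grlift1 : grlift 1%g 1 = 1.
Proof. exact: grliftU. Qed.

Lemma grlift_sum h (I : Type) (r : seq I) (P : pred I) (F : I -> R) :
  grlift h (\sum_(i <- r | P i) F i) = \sum_(i <- r | P i) grlift h (F i).
Proof. exact: (raddf_sum (grlift h)). Qed.

Lemma grlift_natr n : grlift 1%g n%:R = n%:R.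
Proof. by rewrite -[in RHS]grlift1; exact: (raddfMn (grlift 1%g)). Qed.

Lemma grliftM h g a b : grlift h a * grlift g b = grlift (h * g)%g (a * b).
Proof.
rewrite [in RHS]group_ring_mulE grmull grlift_sum {1 2}/grlift mulr_suml.
apply: eq_bigr => k _; rewrite grlift_sum mulr_sumr.
by apply: eq_bigr => l _; rewrite grliftU group_ring_mulE grmulUU.
Qed.

(* For [y] the inverse of [#|X|] and [X] a subgroup, this is the idempotent
   averaging over [X]. *)
Definition gravg (y : R) X : S := \sum_(x in X) grlift x y.

Lemma mcoeff_gravg y X k h : (gravg y X)@_(k, h) = y@_k *+ (h \in X).
Proof.
rewrite /gravg raddf_sum /=; under eq_bigr do rewrite mcoeff_grlift.
case: (boolP (h \in X)) => hX.
  rewrite (bigD1 h) //= eqxx big1 ?addr0 // => i /andP[_ /negbTE ->] //.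
by rewrite big1 // => i iX; case: eqP => // ih; rewrite -ih iX in hX.
Qed.

(** Termwise this is [x * h = h * x ^ h]. It yields both the action of the shift on the idempotents
    and the effect of normality. *)
Lemma gravgJ y X h : gravg y X * grlift h 1 = grlift h 1 * gravg y (X :^ h)%g.
Proof.
rewrite /gravg mulr_suml mulr_sumr /=.
rewrite [RHS](reindex_inj (conjg_inj h)) /=.
apply: eq_big => [x|x _]; first by rewrite memJ_conjg.
by rewrite !grliftM mulr1 mul1r conjgE mulgA mulgV mul1g.
Qed.

Lemma gravgMr y (A : {group H}) h : h \in A -> gravg y A * grlift h 1 = gravg y A.
Proof.
move=> hA; rewrite /gravg mulr_suml [RHS](reindex_inj (mulIg h)) /=.
apply: eq_big => [x|x _]; first by rewrite groupMr.
by rewrite grliftM mulr1.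
Qed.

Lemma gravgMl y (A : {group H}) h : h \in A -> grlift h 1 * gravg y A = gravg y A.
Proof.
move=> hA; rewrite /gravg mulr_sumr [RHS](reindex_inj (mulgI h)) /=.
apply: eq_big => [x|x _]; first by rewrite groupMl.
by rewrite grliftM mul1r.
Qed.

Lemma grlift_gravg a y X : grlift 1%g a * gravg y X = gravg (a * y) X.
Proof.
by rewrite /gravg mulr_sumr; apply: eq_bigr => x _; rewrite grliftM mul1g.
Qed.

Section Central.
Variable y : R.
Hypothesis yC : forall a, y * a = a * y.

Lemma gravgE X : gravg y X = grlift 1%g y * \sum_(x in X) grlift x 1.
Proof.
rewrite mulr_sumr; apply: eq_bigr => x _ /=.
by rewrite grliftM mul1g mulr1.
Qed.

Lemma gravgC a X : grlift 1%g a * gravg y X = gravg y X * grlift 1%g a.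
Proof.
rewrite /gravg [RHS]mulr_suml [LHS]mulr_sumr; apply: eq_bigr => x _ /=.
by rewrite !grliftM mul1g mulg1 yC.
Qed.

(** Every element of [X] fixes [z], so the sum over [X] multiplies [z] by [#|X|], which [y]
    cancels. *)
Lemma gravg_absorbl X (z : S) : #|X|%:R * y = 1 ->
  {in X, forall x, grlift x 1 * z = z} -> gravg y X * z = z.
Proof.
move=> Xy Xz; rewrite gravgE -mulrA.
have -> : (\sum_(x in X) grlift x 1) * z = #|X|%:R * z.
  by rewrite mulr_suml (eq_bigr (fun=> z)) // sumr_const mulr_natl.
rewrite mulrA.
suff -> : grlift 1%g y * #|X|%:R = 1 by rewrite mul1r.
by rewrite -(grlift_natr #|X|) grliftM mulg1 yC Xy grlift1.
Qed.

Lemma gravg_absorbr X (z : S) : #|X|%:R * y = 1 ->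
  {in X, forall x, z * grlift x 1 = z} -> z * gravg y X = z.
Proof.
move=> Xy Xz; have -> : gravg y X = (\sum_(x in X) grlift x 1) * grlift 1%g y.
  by rewrite mulr_suml; apply: eq_bigr => x _; rewrite grliftM mulg1 mul1r.
rewrite mulrA; have -> : z * (\sum_(x in X) grlift x 1) = z * #|X|%:R.
  by rewrite mulr_sumr (eq_bigr (fun=> z)) // sumr_const mulr_natr.
rewrite -mulrA.
suff -> : #|X|%:R * grlift 1%g y = 1 by rewrite mulr1.
by rewrite -(grlift_natr #|X|) grliftM mulg1 Xy grlift1.
Qed.

End Central.

(** * Matrix units from a family of normal subgroups permuted by a shift *)

Section GroupMatrixUnits.
Variables (n : nat) (A : {group H}) (B : 'I_n.+1 -> {group H}) (t : 'I_n.+1 -> H).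
Variables (yA yB : R).
Hypothesis AyA : #|A|%:R * yA = 1.
Hypothesis ByB : forall i, #|B i|%:R * yB = 1.
Hypothesis yAC : forall a, yA * a = a * yA.
Hypothesis yBC : forall a, yB * a = a * yB.
Hypothesis BA : forall i, (B i <| A)%g.
Hypothesis BM : forall i j, i != j -> (B i * B j)%g = A.
Hypothesis BJ : forall i k, (B i :^ t k)%g = B (i + k).
Hypothesis AJ : forall k, (A :^ t k)%g = A.
Hypothesis tD : forall k l, t (k + l) = (t k * t l)%g.
Hypothesis B0A : ~~ (A \subset B 0).

Let f i := gravg yB (B i) - gravg yA A.

Let mem_BA i x : x \in B i -> x \in A.
Proof. exact: (subsetP (normal_sub (BA i))). Qed.

(** [B i] lies in [A], so its elements fix the average over [A]. *)
Let gravgBA i : gravg yB (B i) * gravg yA A = gravg yA A.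
Proof. by apply: gravg_absorbl => // x /mem_BA; apply: gravgMl. Qed.

Let gravgAB i : gravg yA A * gravg yB (B i) = gravg yA A.
Proof. by apply: gravg_absorbr => // x /mem_BA; apply: gravgMr. Qed.

Let gravgAA : gravg yA A * gravg yA A = gravg yA A.
Proof. by apply: gravg_absorbl => // x; apply: gravgMl. Qed.

Let gravgBB i : gravg yB (B i) * gravg yB (B i) = gravg yB (B i).
Proof. by apply: gravg_absorbl => // x; apply: gravgMl. Qed.

(* The product is fixed by [B i] on the left and, [B i] being normal, also by
   [B j], hence by [A]; so averaging it over [A] does not change it. *)
Let gravgBiBj i j : i != j -> gravg yB (B i) * gravg yB (B j) = gravg yA A.
Proof.
move=> nij; rewrite -[RHS](gravgAB j) -[in RHS](gravgAB i) -mulrA.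
apply/esym/gravg_absorbl => // x; rewrite -(BM nij) => /mulsgP[b c bB cB ->].
have -> : grlift (b * c)%g 1 = grlift b 1 * grlift c 1 by rewrite grliftM mulr1.
rewrite -mulrA [grlift c 1 * _]mulrA.
have -> : grlift c 1 * gravg yB (B i) = gravg yB (B i) * grlift c 1.
  have /normsP/(_ c (mem_BA cB)) BiJ := normal_norm (BA i).
  by rewrite gravgJ BiJ.
by rewrite -mulrA gravgMl // mulrA gravgMl.
Qed.

(** Three of the four terms of the product are the average over [A], leaving the product of the
    averages over [B i] and [B j] minus that average. *)
Let fM i j : f i * f j = f i *+ (i == j).
Proof.
rewrite /f mulrBl !mulrBr gravgBA gravgAB gravgAA subrr subr0.
by case: eqVneq => [->|nij]; rewrite ?gravgBB // gravgBiBj // subrr.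
Qed.

Let fT i k : f i * grlift (t k) 1 = grlift (t k) 1 * f (i + k).
Proof. by rewrite /f mulrBl mulrBr !gravgJ BJ AJ. Qed.

Let fTB i j : f i * grlift (t (j - i)) 1 = grlift (t (j - i)) 1 * f j.
Proof. by rewrite fT [i + _]addrC subrK. Qed.

Lemma directly_finite_matrix_group_ring :
  directly_finite S -> directly_finite 'M[R]_n.+1.
Proof.
(* The unit [E i j] goes from [f i] to [f j] through the shift by [j - i], taken modulo [n.+1]. *)
apply: (@directly_finite_matrix R S n (grlift 1%g)
          (fun i j => f i * grlift (t (j - i)) 1)).
- by move=> a b; rewrite grliftM mulg1.
- move=> a i j; rewrite mulrA -[RHS]mulrA grliftM mulg1 mul1r.
  rewrite -[a in RHS]mulr1 -[t _ in RHS]mul1g.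
  rewrite -grliftM mulrA; congr (_ * _).
  by rewrite /f mulrBr mulrBl !gravgC.
(* Moving the shift to the left of the idempotent in [E i j] brings [f j] next to [f k]. *)
- move=> i j k l; rewrite fTB mulrA -[_ * f j * f k]mulrA fM.
  case: eqVneq => [<-|]; last by rewrite mulr0n mulr0 mul0r.
  by rewrite !mulr1n -fTB -mulrA grliftM mulr1 -tD [X in t X]addrC addrA subrK.
move=> a; rewrite subrr.
have t0 : t 0 = 1%g.
  by apply: (mulIg (t 0)); rewrite -tD addr0 mul1g.
rewrite t0 grlift1 mulr1 => af0.
(* At an [x] in [A] outside [B 0] only the average over [A] contributes, so the coefficients of
   [a * f 0] there are those of [- (a * yA)]; then [a] vanishes because [yA] is invertible. *)
have /subsetPn[x xA xB] := B0A.
have a0 : a * yA = 0.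
  apply/malgP => k; have := congr1 (fun z : S => z@_(k, x)) af0.
  rewrite mulrBr !grlift_gravg mcoeffB !mcoeff_gravg xA (negbTE xB) mulr0n mulr1n.
  by rewrite sub0r !mcoeff0 => /eqP; rewrite oppr_eq0 => /eqP.
by rewrite -[a]mulr1 -AyA -yAC mulrA a0 mul0r.
Qed.

End GroupMatrixUnits.

End Lift.

(** * The wreath product, its base group and the coordinate subgroups *)

Section CyclicWreath.
Variables (C : finGroupType) (n : nat).

(* The wreath product of [C] by the additive cyclic group ['I_n.+1]. *)
Definition cyclic_wreath : predArgType := ({ffun 'I_n.+1 -> C} * 'I_n.+1)%type.
HB.instance Definition _ := Finite.on cyclic_wreath.
Implicit Types x y : cyclic_wreath.

Definition cw_one : cyclic_wreath := ([ffun=> 1%g], 0).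
Definition cw_mul x y : cyclic_wreath :=
  ([ffun i => (x.1 i * y.1 (i + x.2))%g], x.2 + y.2).
Definition cw_inv x : cyclic_wreath := ([ffun i => (x.1 (i - x.2))^-1%g], - x.2).

Fact cw_mulA : associative cw_mul.
Proof.
move=> x y z; rewrite /cw_mul /= addrA; congr pair.
by apply/ffunP => i; rewrite !ffunE /= mulgA addrA.
Qed.

Fact cw_mul1 : left_id cw_one cw_mul.
Proof.
case=> v k; rewrite /cw_mul /= add0r; congr pair.
by apply/ffunP => i; rewrite !ffunE /= mul1g addr0.
Qed.

Fact cw_mulV : left_inverse cw_one cw_inv cw_mul.
Proof.
case=> v k; rewrite /cw_mul /= addNr; congr pair.
by apply/ffunP => i; rewrite !ffunE /= mulVg.
Qed.

HB.instance Definition _ := Finite_isGroup.Build cyclic_wreath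
  cw_mulA cw_mul1 cw_mulV.

Lemma cw_mulE x y : (x * y)%g = cw_mul x y. Proof. by []. Qed.
Lemma cw_invE x : (x^-1)%g = cw_inv x. Proof. by []. Qed.

(** The base group, a power of [C], will serve as [A]; the kernel [cw_face i] of its projection to
    coordinate [i] will serve as [B i], and [cw_shift] as [t]. *)
Definition cw_base : {set cyclic_wreath} :=
  [set x : cyclic_wreath | x.2 == 0].
Definition cw_face (i : 'I_n.+1) : {set cyclic_wreath} :=
  [set x : cyclic_wreath | (x.2 == 0) && (x.1 i == 1%g)].
Definition cw_shift (k : 'I_n.+1) : cyclic_wreath := ([ffun=> 1%g], k).

Fact cw_base_group_set : group_set cw_base.
Proof.
apply/group_setP; split=> [|x y]; first by rewrite inE.
by rewrite !inE => /eqP x0 /eqP y0; rewrite cw_mulE /= x0 y0 addr0.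
Qed.
Canonical cw_base_group := Group cw_base_group_set.

Fact cw_face_group_set i : group_set (cw_face i).
Proof.
apply/group_setP; split=> [|x y]; first by rewrite inE /= ffunE !eqxx.
rewrite !inE => /andP[/eqP x0 /eqP xi] /andP[/eqP y0 /eqP yi].
by rewrite cw_mulE /= ffunE x0 y0 !addr0 xi yi mulg1 !eqxx.
Qed.
Canonical cw_face_group i := Group (cw_face_group_set i).

Lemma cw_conjE x y : y \in cw_base ->
  (y ^ x)%g = ([ffun i => (y.1 (i - x.2) ^ x.1 (i - x.2))%g], 0) :> cyclic_wreath.
Proof.
rewrite inE => /eqP y0; rewrite conjgE !cw_mulE cw_invE /cw_mul /cw_inv /=.
rewrite y0 add0r addNr; congr pair.
by apply/ffunP => i; rewrite !ffunE /= conjgE addr0 !mulgA.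
Qed.

Lemma cw_base_normal i : (cw_face i <| cw_base)%g.
Proof.
have sub : cw_face i \subset cw_base.
  by apply/subsetP => x; rewrite !inE => /andP[].
apply/normalP; split=> // x xA.
(* A conjugate has the same cardinality, so inclusion suffices; base elements conjugate
   coordinatewise and keep coordinate [i] trivial. *)
suff sJ y : y \in cw_base -> (cw_face i :^ y \subset cw_face i)%g.
  by apply/eqP; rewrite eqEcard cardJg leqnn andbT sJ.
move=> yA; apply/subsetP => _ /imsetP[z zB ->].
rewrite cw_conjE ?(subsetP sub) //; move: yA zB; rewrite !inE => /eqP y0 /andP[_ /eqP zi].
by rewrite /= ffunE y0 subr0 zi conj1g !eqxx.
Qed.

Lemma cw_faceM i j : i != j -> (cw_face i * cw_face j)%g = cw_base.
Proof.
move=> nij; apply/setP => x; apply/mulsgP/idP => [[y z]|].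
  rewrite !inE => /andP[/eqP y0 _] /andP[/eqP z0 _] ->.
  by rewrite cw_mulE /= y0 z0 addr0.
rewrite inE => /eqP x0.
(* The second factor carries coordinate [i] of [x], the first all the others; the second is trivial
   at [j] since [i != j]. *)
exists ([ffun k => if k == i then 1%g else x.1 k], 0)
       ([ffun k => if k == i then x.1 k else 1%g], 0).
- by rewrite inE /= ffunE !eqxx.
- by rewrite inE /= ffunE [j == i]eq_sym (negbTE nij) !eqxx.
rewrite cw_mulE /cw_mul /= addr0 [LHS]surjective_pairing x0; congr pair.
by apply/ffunP => k; rewrite !ffunE addr0; case: eqP; rewrite ?mul1g ?mulg1.
Qed.

Lemma cw_baseJ k : (cw_base :^ cw_shift k)%g = cw_base.
Proof.
apply/eqP; rewrite eqEcard cardJg leqnn andbT.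
by apply/subsetP => _ /imsetP[x xA ->]; rewrite cw_conjE // inE.
Qed.

Lemma cw_shiftD k l : cw_shift (k + l) = (cw_shift k * cw_shift l)%g.
Proof.
by rewrite cw_mulE; congr pair; apply/ffunP => i; rewrite !ffunE mulg1.
Qed.

Lemma cw_faceJ i k : (cw_face i :^ cw_shift k)%g = cw_face (i + k).
Proof.
have sub j l : (cw_face j :^ cw_shift l)%g \subset cw_face (j + l).
  apply/subsetP => _ /imsetP[x xB ->].
  have xA : x \in cw_base by move: xB; rewrite !inE => /andP[].
  move: xB; rewrite cw_conjE // !inE /= => /andP[_ /eqP xj].
  by rewrite ffunE addrK xj conj1g !eqxx.
apply/eqP; rewrite eqEsubset sub /=.
(* The reverse inclusion is the same one for the opposite shift, conjugated back. *)
have := sub (i + k) (- k); rewrite addrK.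
suff -> : cw_shift (- k) = (cw_shift k)^-1%g by rewrite sub_conjgV.
apply: (mulgI (cw_shift k)); rewrite mulgV -cw_shiftD subrr.
by [].
Qed.

Lemma card_cw_base : #|cw_base| = (#|C| ^ n.+1)%N.
Proof.
have -> : cw_base = [set (v, 0) | v : {ffun 'I_n.+1 -> C}].
  apply/setP => x; rewrite inE; apply/eqP/imsetP => [x0|[v _ ->] //].
  by exists x.1; rewrite // [LHS]surjective_pairing x0.
rewrite card_imset => [|v w [] //].
by rewrite card_ffun card_ord.
Qed.

(** The shifts conjugate these subgroups into one another, so a single inverse [yB] serves them
    all. *)
Lemma card_cw_face i : #|cw_face i| = #|cw_face 0|.
Proof. by rewrite -[i]add0r -cw_faceJ cardJg. Qed.

Lemma cw_base_nsub_face i : (1 < #|C|)%N -> ~~ (cw_base \subset cw_face i).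
Proof.
rewrite -cardsT => /(@card_gt1P C).
case=> c [d] [_ _ ncd].
apply/negP => /subsetP sAB.
(* The constant family [e] lies in the base group, so the inclusion would make [C] trivial. *)
have eq1 e : e = 1%g :> C.
  have := sAB ([ffun=> e], 0); rewrite !inE /= ffunE eqxx => /(_ isT).
  by move/eqP.
by rewrite (eq1 c) (eq1 d) eqxx in ncd.
Qed.

End CyclicWreath.

(** * Inverting the group orders and choosing the cyclic group *)

Lemma natr_inv_central (R : nzRingType) m (y a : R) :
  m%:R * y = 1 -> y * a = a * y.
Proof.
move=> my; have ym : y * m%:R = 1 by rewrite commr_nat.
(* As [m] is central, [y * a = y * a * m * y = y * m * a * y = a * y]. *)
by rewrite -[LHS]mulr1 -my mulrA -[y * a * _]mulrA commr_nat mulrA ym mul1r.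
Qed.

Lemma directly_finite_matrix_wreath (K : nzRingType) (G : groupType)
    (C : finGroupType) (u : K) n :
  (1 < #|C|)%N -> #|C|%:R * u = 1 ->
  directly_finite (group_ring K (prod_group G (cyclic_wreath C n))) ->
  directly_finite 'M[group_ring K G]_n.+1.
Proof.
move=> C1 Cu.
have [v Cv] : exists v : group_ring K G, #|C|%:R * v = 1.
  exists << u *g 1%g >>; apply/malgP => k.
  rewrite mulr_natl mcoeffMn mcoeffU.
  rewrite [RHS]mcoeffU -mulrnA mulnC mulrnA -Cu mulr_natl.
  by [].
have inv (X : {set cyclic_wreath C n}) : (#|X| %| #|cw_base C n|)%N ->
    exists y : group_ring K G, #|X|%:R * y = 1.
  move=> /dvdnP[q]; rewrite card_cw_base => cq.
  (* With [q * #|X| = #|C| ^ n.+1], the cofactor [q] times the inverse of that power inverts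
     [#|X|]. *)
  exists (q%:R * v ^+ n.+1); rewrite mulrA -natrM mulnC -cq natrX.
  by rewrite -exprMn_comm ?Cv ?expr1n //; exact/commr_sym/commr_nat.
have [yA AyA] := inv _ (dvdnn _).
have [yB B0yB] := inv _ (cardSg (normal_sub (cw_base_normal C 0))).
apply: (@directly_finite_matrix_group_ring K G _ n (cw_base_group C n)
  (@cw_face_group C n) (@cw_shift C n) yA yB).
- exact: AyA.
- by move=> i; rewrite card_cw_face.
- by move=> a; apply: natr_inv_central AyA.
- by move=> a; apply: natr_inv_central B0yB.
- exact: cw_base_normal.
- exact: cw_faceM.
- exact: cw_faceJ.
- exact: cw_baseJ.
- exact: cw_shiftD.
- exact: cw_base_nsub_face.
Qed.

(* K a division ring, Gamma a group: if K[Gamma x H] is directly finite for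
   every finite group H, then K[Gamma] is stably finite. *)
Theorem theorem3p3 (K : nzRingType) (Gamma : groupType) :
  is_division_ring K ->
  (forall H : finGroupType, directly_finite (group_ring K (prod_group Gamma H))) ->
  stably_finite (group_ring K Gamma).
Proof.
move=> divK dfK m.
(* If 2 is nonzero in [K] it is invertible and [C] has order 2. Otherwise [C] has order 3, and 3 = 2
   + 1 = 1 in [K] is its own inverse. *)
have [two0|/divK[u [u2 _]]] := eqVneq (2%:R : K) 0; last first.
  by apply: (@directly_finite_matrix_wreath K Gamma 'I_2 u);
     rewrite ?card_ord //; apply: dfK.
apply: (@directly_finite_matrix_wreath K Gamma 'I_3 1);
  rewrite ?card_ord //; last exact: dfK.
by rewrite mulr1 -addn1 natrD two0 add0r.
Qed.
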